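(* Let $n\ge 5$ be an integer and let $T\in \mathcal{CT}_n$. (1) If $n\equiv 2 \pmod 3$, then $$e^{SO_{red}}(T)\le \frac{2}{3}(n+1) e^3+\frac{1}{3}(n-5) e^{3 \sqrt{2}},$$ with equality if and only if $n_2(T)=n_3(T)=0$. (2) If $n\equiv 1 \pmod 3$, then $$e^{SO_{red}}(T)\le 2 e^2+e^{\sqrt{13}}+\frac{1}{3} (2 n-5) e^3+\frac{1}{3} (n-7)e^{3 \sqrt{2}},$$ with equality if and only if $n_2(T)=0$, $n_3(T)=1$, $m_{13}(T)=2$, and $m_{34}(T)=1$. (3) If $n\equiv 0 \pmod 3$, then $$e^{SO_{red}}(T)\le e+e^{\sqrt{10}}+\frac{1}{3}(2n-3) e^3+\frac{1}{3} (n-6) e^{3 \sqrt{2}},$$ with equality if and only if $n_2(T)=1$, $n_3(T)=0$, and $m_{12}(T)=m_{24}(T)=1$.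
   Context: A chemical tree is a (finite) tree $T$ in which every vertex $v$ has degree $d_T(v)\le 4$. $\mathcal{CT}_n$ denotes the set of all chemical trees of order $n$ (i.e. with $n$ vertices). For a chemical tree $T$, $n_i(T)$ is the number of vertices of degree $i$, and $m_{ij}(T)$ is the number of edges joining a vertex of degree $i$ and a vertex of degree $j$. The exponential reduced Sombor index of a graph $G$ with edge set $E(G)$ and vertex degrees $d(v)$ is $$e^{SO_{red}}(G)=\sum_{uv\in E(G)}e^{\sqrt{(d(u)-1)^2+(d(v)-1)^2}}.$$ *)

(* Defs.v *)
From HB Require Import structures.
From mathcomp Require Import all_boot all_order all_algebra.
From mathcomp Require Import reals sequences exp.

Set Implicit Arguments.
Unset Strict Implicit.
Unset Printing Implicit Defensive.

Import Order.TTheory GRing.Theory Num.Theory.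
Local Open Scope ring_scope.

Record sgraph := SGraph {
  svertex :> finType;
  adj : rel svertex;
  adj_sym : symmetric adj;
  adj_irrefl : irreflexive adj
}.

Definition deg (G : sgraph) (v : G) : nat := #|[set w | adj v w]|.

(* Edges are unordered pairs, so each edge is counted once. *)
Definition edges (G : sgraph) : {set {set G}} :=
  [set [set p.1; p.2] | p : G * G & adj p.1 p.2].

Definition connected_graph (G : sgraph) : Prop :=
  (0 < #|G|)%N /\ forall u v : G, connect (@adj G) u v.

(* In a simple graph, ucycle also holds of [::] and of [:: u; v] with u, v
   adjacent; these are not cycles of the graph. *)
Definition acyclic_graph (G : sgraph) : Prop :=
  forall c : seq G, ucycle (@adj G) c -> (size c < 3)%N.

Definition is_tree (G : sgraph) : Prop := connected_graph G /\ acyclic_graph G.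

Definition chemical_tree (G : sgraph) : Prop :=
  is_tree G /\ forall v : G, (deg v <= 4)%N.

Definition CT (n : nat) (G : sgraph) : Prop := chemical_tree G /\ #|G| = n.

Definition n_deg (G : sgraph) (i : nat) : nat := #|[set v : G | deg v == i]|.

Definition m_deg (G : sgraph) (i j : nat) : nat :=
  #|[set [set p.1; p.2] | p : G * G &
      [&& adj p.1 p.2, deg p.1 == i & deg p.2 == j]]|.

(* For an edge E = {u, v} the inner sum is (d(u) - 1)^2 + (d(v) - 1)^2. *)
Definition eSOred (R : realType) (G : sgraph) : R :=
  \sum_(E in edges G) expR (Num.sqrt (\sum_(w in E) ((deg w)%:R - 1) ^+ 2)).

(* Main.v *)
Require Import Defs.
From HB Require Import structures.
From mathcomp Require Import all_boot all_order all_algebra.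
From mathcomp Require Import reals topology normedtype sequences exp.
From mathcomp Require Import zify ring lra.

(** Write w i j for the weight exp (sqrt ((i-1)^2 + (j-1)^2)) of an edge whose
    ends have degrees i and j, and m i j for the number of such edges.  Every
    vertex has degree at most 4, so the two identities
    sum m i j = n - 1 (a tree has n - 1 edges) and
    sum m i j (1/i + 1/j) = n (each vertex collects 1 from its own edges)
    determine m 1 4 and m 4 4 from n and the remaining m i j, where m 1 1 = 0
    because n > 2 ([chemical_tree_counts]).  Eliminating them turns the index into
<<
      2/3 (n+1) w 1 4 + 1/3 (n-5) w 4 4 - sum d i j * m i j,
>>
    where the deficiency d i j compares w i j with the affine function of
    1/i + 1/j through the two extreme edge types 1-4 and 4-4
    ([eSOred_deficiency]).  Numerically
<<
      d 1 2 = 0.87   d 2 2 = 32.5   d 3 3 = 41.7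
      d 1 3 = 7.2    d 2 3 = 38.2   d 3 4 = 27.3
                     d 2 4 = 29.5
>>
    so all deficiencies are positive, and those of inner edges (edges with no
    leaf and with at least one end of degree 2 or 3) are large.  Maximizing the
    index means minimizing the total deficiency.

    Since n2 + 2 n3 + 3 n4 = n - 2, the residue of n modulo 3 is that of
    n2 + 2 n3 + 2.  If n = 2 mod 3, total deficiency 0 can occur, exactly when
    n2 = n3 = 0.  In the other two cases some vertex has degree 2 or 3; by
    connectedness not all its neighbours are leaves ([dart_deg_leaves]), so
    there is an inner edge.  Two inner edges cost more than 50, while the
    claimed optima are 2 d 1 3 + d 3 4 = 41.7 (n = 1 mod 3) and
    d 1 2 + d 2 4 = 30.3 (n = 0 mod 3).  With a single inner edge only a
    handful of degree configurations survive ([one_inner_edge]); besides the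
    two optima, the residue classes leave only configurations with a 3-3 edge,
    which are more expensive ([deficiency_trichotomy]). *)

Set Implicit Arguments.
Unset Strict Implicit.
Unset Printing Implicit Defensive.

Import Order.TTheory GRing.Theory Num.Theory.

(** * Counting edges through ordered pairs *)

Lemma eq_set2 (T : finType) (a b c d : T) : c != d ->
  ([set a; b] == [set c; d]) = ((a, b) == (c, d)) || ((a, b) == (d, c)).
Proof.
move=> cd; apply/eqP/orP; last first.
  by case=> /eqP[-> ->] //; rewrite setUC.
move=> E.
have : b \in [set c; d] by rewrite -E set22.
have : a \in [set c; d] by rewrite -E set21.
move=> /set2P[] aE /set2P[] bE; subst a b; rewrite ?eqxx; auto.
- by move: (set22 c d); rewrite -E !inE orbb eq_sym (negbTE cd).
- by move: (set21 c d); rewrite -E !inE orbb (negbTE cd).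
Qed.

(** Sums over ordered pairs of adjacent vertices (darts) split by their first
    end, which sums over unordered edges do not.  Each edge is the image of
    exactly two darts, so both kinds of sums carry the same information. *)
Lemma sum_darts_edges (V : nmodType) (G : sgraph) (P : pred (G * G))
    (F : {set G} -> V) :
  (forall u v, P (u, v) -> adj u v) -> (forall u v, P (u, v) = P (v, u)) ->
  (\sum_(p | P p) F [set p.1; p.2] =
  (\sum_(E in [set [set p.1; p.2] | p : G * G & P p]) F E) *+ 2)%R.
Proof.
move=> Padj Psym.
rewrite (@partition_big_imset _ _ _ _ _ (fun p : G * G => [set p.1; p.2]) P) /=.
rewrite -sumrMnl; apply: eq_big => [E|E /imsetP[[u v] Puv ->{E}] /=].
  by apply/imsetP/imsetP => -[p Pp ->]; exists p; rewrite ?inE in Pp *.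
have Puv' : P (u, v) by [].
have uv : u != v.
  by apply/eqP=> uv; move: (Padj _ _ Puv'); rewrite uv adj_irrefl.
rewrite (eq_bigl (mem [set (u, v); (v, u)])); last first.
  move=> [a b] /=; rewrite eq_set2 // !inE.
  case: (eqVneq (a, b) (u, v)) => [->|_]; first by rewrite -topredE /= Puv'.
  case: (eqVneq (a, b) (v, u)) => [->|_]; last by rewrite andbF.
  by rewrite -topredE /= Psym Puv'.
rewrite big_setU1 /=; last by rewrite inE xpair_eqE negb_and uv.
by rewrite big_set1 /= mulr2n (setUC [set v]).
Qed.

Definition dart_deg (G : sgraph) (i j : nat) : nat :=
  #|[set p : G * G | [&& adj p.1 p.2, deg p.1 == i & deg p.2 == j]]|.

(** When the two end degrees differ they orient the edge, so that each edge
    comes from a single dart. *)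
Lemma dart_deg_neq (G : sgraph) i j : i != j -> dart_deg G i j = m_deg G i j.
Proof.
move=> ij; rewrite /dart_deg /m_deg.
rewrite (_ : imset _ _ = [set [set p.1; p.2] | p in
  [set p : G * G | [&& adj p.1 p.2, deg p.1 == i & deg p.2 == j]]]); last first.
  apply/setP => E.
  by apply/imsetP/imsetP => -[p Pp ->]; exists p; rewrite ?inE in Pp *.
rewrite card_in_imset // => -[u v] [a b]; rewrite !inE /=.
move=> /and3P[_ /eqP du /eqP dv] /and3P[ab /eqP da /eqP db] /eqP.
rewrite eq_set2; last by apply: contraTneq ab => ->; rewrite adj_irrefl.
case/orP=> /eqP // [uE vE].
by move: ij; rewrite -du -db uE eqxx.
Qed.

Lemma dart_deg_eq (G : sgraph) i : dart_deg G i i = (m_deg G i i).*2.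
Proof.
rewrite /dart_deg -sum1dep_card (sum_darts_edges (V := nat) (fun _ => 1%N)).
- by rewrite mulr2n sum1_card -addnn.
- by move=> u v /and3P[].
- by move=> u v /=; rewrite adj_sym [(deg u == i) && _]andbC.
Qed.

Lemma dart_deg_sym (G : sgraph) i j : dart_deg G i j = dart_deg G j i.
Proof.
rewrite /dart_deg -!sum1dep_card (reindex_inj (h := fun p : G * G => (p.2, p.1))) /=; last first.
  by move=> [a b] [c d] [-> ->].
by apply: eq_bigl => -[u v] /=; rewrite adj_sym [(deg v == i) && _]andbC.
Qed.

(** The indices are shifted so that they range over the possible degrees of a
    graph without isolated vertices. *)
Lemma sum_darts_by_degree (V : nmodType) (G : sgraph) k (g : nat -> nat -> V) :
  (forall v : G, 0 < deg v <= k)%N ->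
  (\sum_(p : G * G | adj p.1 p.2) g (deg p.1) (deg p.2) =
  \sum_(i < k) \sum_(j < k) g i.+1 j.+1 *+ dart_deg G i.+1 j.+1)%R.
Proof.
move=> dk.
have predk (v : G) : ((deg v).-1 < k)%N by have := dk v; lia.
have predK (v : G) : (deg v).-1.+1 = deg v by have := dk v; lia.
rewrite pair_big /=.
rewrite (partition_big (fun p : G * G => (Ordinal (predk p.1), Ordinal (predk p.2)))
  predT) //=.
apply: eq_bigr => -[i j] _ /=.
rewrite /dart_deg -sum1dep_card -sumrMnr big_mkcond [RHS]big_mkcond /=.
apply: eq_bigr => -[u v] _ /=.
rewrite xpair_eqE -!val_eqE /=.
rewrite -(predK u) -(predK v) !eqSS.
case: (adj u v) => //=.
by case: eqP => //= ->; case: eqP => //= ->; rewrite mulr1n.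
Qed.

(** * Connectedness, acyclicity and the number of edges *)

Lemma deg_sum (G : sgraph) (v : G) : deg v = \sum_(w : G) adj v w.
Proof. by rewrite /deg -sum1dep_card big_mkcond; apply: eq_bigr => w _; case: ifP. Qed.

Lemma connected_closed (G : sgraph) (S : {set G}) (x : G) :
  connected_graph G -> x \in S -> (forall u v, u \in S -> adj u v -> v \in S) ->
  S = [set: G].
Proof.
move=> [_ conn] xS Scl; apply/setP => y; rewrite inE.
have /connectP[p] := conn x y.
elim: p x xS => [|z p IHp] x xS /=; first by move=> _ ->.
by case/andP=> xz; apply: IHp; apply: Scl xz.
Qed.

Lemma deg_gt0 (G : sgraph) (v : G) : connected_graph G -> (1 < #|G|)%N -> (0 < deg v)%N.
Proof.
move=> conn G1; rewrite lt0n; apply/negP => /eqP/cards0_eq N0.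
have E : [set v] = [set: G].
  apply: (connected_closed (x := v)) => // [|u w]; first by rewrite inE.
  rewrite inE => /eqP-> vw.
  have : w \in [set w | adj v w] by rewrite inE.
  by rewrite N0 in_set0.
by move: G1; rewrite -cardsT -E cards1.
Qed.

Definition adj_in (G : sgraph) (S : {set G}) : rel G :=
  [rel u v | [&& adj u v, u \in S & v \in S]].

(** Two neighbours x, x' of y inside S would be joined by a simple path in S,
    and y would close this path into a cycle. *)
Lemma tree_one_neighbour (G : sgraph) (S : {set G}) (x x' y : G) :
  acyclic_graph G -> {in S &, forall u v, connect (adj_in S) u v} ->
  y \notin S -> x \in S -> x' \in S -> adj x y -> adj x' y -> x = x'.
Proof.
move=> acyc conn yS xS x'S xy x'y; apply/eqP/negPn/negP => xx'.
have /connectP[p0 p0P x'E] := conn _ _ xS x'S.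
move: x'E; case/shortenP: p0P => p pP pU _ x'E.
have pS : path (@adj G) x p /\ all (mem S) p.
  elim: p x xS pP {pU xy xx' x'E} => //= z p IHp x xS /andP[/and3P[xz _ zS] zp].
  by have [-> ->] := IHp z zS zp; rewrite xz zS.
(* The cycle has length at least 3 because x and x' differ. *)
have /acyc : ucycle (@adj G) [:: y, x & p].
  apply/andP; split => /=.
    by rewrite adj_sym xy /= rcons_path -x'E x'y pS.1.
  move: pU => /= ->; rewrite andbT inE negb_or.
  apply/andP; split; first by apply: contraNneq yS => ->.
  by apply: contra yS => yp; have /allP/(_ y yp) := pS.2.
by move=> /=; case: p {pP pU pS} x'E xx' => [/= ->|//]; rewrite eqxx.
Qed.

Lemma connected_boundary (G : sgraph) (S : {set G}) (x : G) :
  connected_graph G -> x \in S -> (#|S| < #|G|)%N ->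
  exists u v, [/\ u \in S, v \notin S & adj u v].
Proof.
move=> conn xS SG.
have [/existsP[u /existsP[v /and3P[]]]|/existsPn N] :=
  boolP [exists u, exists v, [&& u \in S, v \notin S & adj u v]].
  by exists u, v.
move: SG; rewrite (connected_closed (x := x) (S := S)) // ?cardsT ?ltnn // => u v uS uv.
by have /existsPn/(_ v) := N u; rewrite uS uv andbT /= negbK.
Qed.

(** The number of edges of a tree is found by growing a subtree one vertex at a
    time: connectedness supplies an edge leaving S, and its outer end has, by
    acyclicity, a single neighbour in S, so each step adds one edge (two
    darts).  Growing avoids having to find leaves and to pass to induced
    subgraphs. *)
Lemma tree_grow (G : sgraph) k : is_tree G -> (k < #|G|)%N ->
  exists S : {set G}, [/\ #|S| = k.+1,
    {in S &, forall u v, connect (adj_in S) u v}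
    & \sum_(u in S) \sum_(v in S) adj u v = (k.*2)%N].
Proof.
move=> [conn acyc]; elim: k => [|k IHk] kG.
  have /card_gt0P[x _] := conn.1.
  exists [set x]; rewrite cards1; split=> //; last by rewrite !big_set1 adj_irrefl.
  by move=> u v; rewrite !inE => /eqP-> /eqP->; apply: connect0.
have [S [Sk Sconn Ssum]] := IHk (ltnW kG).
have [x0 x0S] : exists x, x \in S by apply/set0Pn; rewrite -card_gt0 Sk.
have [|x [y [xS yS xy]]] := connected_boundary conn x0S; first by rewrite Sk.
have sub u v : connect (adj_in S) u v -> connect (adj_in (y |: S)) u v.
  apply: connect_sub => a b /and3P[ab aS bS].
  by apply: connect1; rewrite /adj_in /= ab !inE aS bS !orbT.
have xy1 : connect (adj_in (y |: S)) x y.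
  by apply: connect1; rewrite /adj_in /= xy !inE xS eqxx orbT.
have yx1 : connect (adj_in (y |: S)) y x.
  by apply: connect1; rewrite /adj_in /= adj_sym xy !inE xS eqxx orbT.
exists (y |: S); split; first by rewrite cardsU1 yS Sk.
  move=> u v /setU1P[->|uS] /setU1P[->|vS].
  - exact: connect0.
  - by apply: connect_trans yx1 _; apply/sub/Sconn.
  - by apply: connect_trans _ xy1; apply/sub/Sconn.
  - by apply/sub/Sconn.
have ysum : \sum_(v in S) adj y v = 1%N.
  rewrite (bigD1 x) //= adj_sym xy big1 // => v /andP[vS vx].
  apply/eqP; rewrite eqb0; apply: contra vx => yv; apply/eqP.
  by apply: (tree_one_neighbour acyc Sconn yS) => //; rewrite adj_sym.
rewrite big_setU1 //= big_setU1 //= adj_irrefl ysum.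
under eq_bigr do rewrite big_setU1 //=.
rewrite big_split /= Ssum.
under eq_bigr do rewrite adj_sym.
by rewrite ysum doubleS.
Qed.

Lemma tree_handshake (G : sgraph) : is_tree G ->
  \sum_(v : G) deg v = (#|G|.-1).*2.
Proof.
move=> tG; have G0 := tG.1.1.
have [|S [Sk _ Ssum]] := @tree_grow G #|G|.-1 tG; first by rewrite prednK.
have ST : S = [set: G].
  by apply/eqP; rewrite eqEcard subsetT cardsT Sk prednK /=.
rewrite -Ssum ST; apply: eq_big => [v|v _]; first by rewrite inE.
by rewrite deg_sum; apply: eq_bigl => w; rewrite inE.
Qed.

Lemma leaf_neighbour (G : sgraph) (u v w : G) :
  deg v = 1%N -> adj u v -> adj v w -> w = u.
Proof.
move=> /eqP/cards1P[x Nx] uv vw.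
have : w \in [set w | adj v w] by rewrite inE.
have : u \in [set w | adj v w] by rewrite inE adj_sym.
by rewrite Nx !inE => /eqP-> /eqP.
Qed.

(** A vertex with only leaves around it is a closed star, hence the whole
    graph. *)
Lemma star_card (G : sgraph) (u : G) : connected_graph G ->
  (forall v, adj u v -> deg v = 1%N) -> (#|G| <= (deg u).+1)%N.
Proof.
move=> conn leaf.
have E : u |: [set w | adj u w] = [set: G].
  apply: (connected_closed (x := u)) => //; first exact: setU11.
  move=> a b /setU1P[->|]; first by rewrite !inE => ->; rewrite orbT.
  rewrite inE => ua ab.
  by rewrite (leaf_neighbour (leaf _ ua) ua ab) setU11.
by rewrite -cardsT -E cardsU1 inE adj_irrefl.
Qed.

Lemma dart_deg_rows (G : sgraph) i j :
  dart_deg G i j = \sum_(u : G | deg u == i) #|[set v | adj u v & deg v == j]|.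
Proof.
rewrite /dart_deg -sum1dep_card.
under [RHS]eq_bigr do rewrite -sum1dep_card.
rewrite pair_big_dep /=; apply: eq_bigl => -[u v] /=.
by rewrite andbCA.
Qed.

Lemma dart_deg_row_sum (G : sgraph) i k : (forall v : G, 0 < deg v <= k)%N ->
  \sum_(j < k) dart_deg G i j.+1 = (i * n_deg G i)%N.
Proof.
move=> dk.
under eq_bigr do rewrite dart_deg_rows.
rewrite exchange_big /= /n_deg -sum1dep_card big_distrr /=.
apply: eq_bigr => u /eqP <-; rewrite muln1 [RHS]/deg -sum1dep_card.
have predk (v : G) : ((deg v).-1 < k)%N by have := dk v; lia.
rewrite (partition_big (fun v : G => Ordinal (predk v)) predT) //=.
apply: eq_bigr => j _; rewrite -sum1dep_card; apply: eq_bigl => v.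
by rewrite -val_eqE /=; have := dk v; case: (deg v).
Qed.

(** In a graph with more than i + 1 vertices a vertex of degree i cannot have
    leaves only around it.  The case i = 1 says that no edge joins two
    leaves. *)
Lemma dart_deg_leaves (G : sgraph) i : connected_graph G -> (i.+1 < #|G|)%N ->
  (dart_deg G i 1 <= i.-1 * n_deg G i)%N.
Proof.
move=> conn iG.
rewrite dart_deg_rows /n_deg -sum1dep_card big_distrr /=.
apply: leq_sum => u /eqP du; rewrite muln1.
have lt : ([set v | adj u v & deg v == 1%N] \proper [set v | adj u v]).
  rewrite properEneq; apply/andP; split; last first.
    by apply/subsetP => v; rewrite !inE => /andP[].
  apply/eqP => E; move: iG; rewrite ltnNge -du star_card // => v uv.
  have : v \in [set v | adj u v] by rewrite inE.
  by rewrite -E inE => /andP[_ /eqP].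
by have := proper_card lt; rewrite -/(deg u) du; case: (i).
Qed.

(** If vertices of degree 2 exist but none is adjacent to a vertex of larger
    degree, then these vertices and their leaf neighbours form a closed set: the
    graph is a path or a cycle.  This is what rules out two adjacent vertices of
    degree 2 as the only inner edge. *)
Lemma path_of_deg2 (G : sgraph) (x : G) : connected_graph G -> deg x = 2%N ->
  (forall u v : G, adj u v -> deg u = 2%N -> (deg v <= 2)%N) ->
  forall v : G, (deg v <= 2)%N.
Proof.
move=> conn dx le2.
pose S := [set w : G | (deg w == 2%N) || [exists u, adj u w && (deg u == 2%N)]].
have SP w : w \in S -> (deg w <= 2)%N.
  rewrite inE => /orP[/eqP->//|/existsP[u /andP[uw /eqP du]]].
  exact: le2 du.
have E : S = [set: G].
  apply: (connected_closed (x := x)) => //; first by rewrite inE dx.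
  move=> a b aS ab; rewrite inE.
  have := aS; rewrite inE; have [da _|da /= /existsP[u /andP[ua du]]] := eqVneq (deg a) 2%N.
    by apply/orP; right; apply/existsP; exists a; rewrite ab da.
  have da1 : deg a = 1%N.
    have a0 : (0 < deg a)%N by apply/card_gt0P; exists b; rewrite inE.
    by have := SP a aS; lia.
  by rewrite (leaf_neighbour da1 ua ab) du.
by move=> v; apply: SP; rewrite E.
Qed.

(** * Degree counts in chemical trees *)

Lemma CT_deg_bounds n (G : sgraph) : (1 < n)%N -> CT n G ->
  forall v : G, 0 < deg v <= 4.
Proof.
move=> n1 [[[conn _] d4] Gn] v.
by rewrite d4 andbT deg_gt0 // Gn.
Qed.

Lemma m_deg_sym (G : sgraph) i j : m_deg G i j = m_deg G j i.
Proof.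
have [->//|ij] := eqVneq i j.
by rewrite -!dart_deg_neq // 1?eq_sym // dart_deg_sym.
Qed.

Lemma sum_by_degree (G : sgraph) k (g : nat -> nat) :
  (forall v : G, 0 < deg v <= k) ->
  \sum_(v : G) g (deg v) = \sum_(i < k) g i.+1 * n_deg G i.+1.
Proof.
move=> dk.
have predk (v : G) : ((deg v).-1 < k)%N by have := dk v; lia.
rewrite (partition_big (fun v : G => Ordinal (predk v)) predT) //=.
apply: eq_bigr => i _; rewrite /n_deg -sum1dep_card big_distrr /=.
apply: eq_big => v; last first.
  by rewrite -val_eqE muln1 /= => /eqP <-; have := dk v; case: (deg v).
by rewrite -val_eqE /=; have := dk v; case: (deg v).
Qed.

(** Everything the extremal argument uses about the tree: the degree equations,
    the handshake identity, and the consequences of connectedness that exclude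
    small components. *)
Lemma chemical_tree_counts n (G : sgraph) : (5 <= n)%N -> CT n G ->
  let n_ := n_deg G in let m := m_deg G in
  [/\ [/\ n_ 1 = m 1 2 + m 1 3 + m 1 4,
      2 * n_ 2 = m 1 2 + 2 * m 2 2 + m 2 3 + m 2 4,
      3 * n_ 3 = m 1 3 + m 2 3 + 2 * m 3 3 + m 3 4 &
      4 * n_ 4 = m 1 4 + m 2 4 + m 3 4 + 2 * m 4 4],
      n_ 1 + n_ 2 + n_ 3 + n_ 4 = n,
      n_ 1 + 2 * n_ 2 + 3 * n_ 3 + 4 * n_ 4 = 2 * n.-1 &
      [/\ m 1 1 = 0, m 1 2 <= n_ 2, m 1 3 <= 2 * n_ 3 &
      0 < n_ 2 -> m 2 3 = 0 -> m 2 4 = 0 -> n_ 3 + n_ 4 = 0]]%N.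
Proof.
move=> n5 TG /=; have [[[conn acyc] d4] Gn] := TG.
have n1 : (1 < n)%N by lia.
have dk := CT_deg_bounds n1 TG.
have row i := dart_deg_row_sum i dk.
have hs := @tree_handshake G (conj conn acyc).
have degs := @sum_by_degree G 4 id dk.
have card := @sum_by_degree G 4 (fun => 1%N) dk.
rewrite /= sum1_card Gn in card; rewrite /= hs Gn in degs.
have leaves i : i < 4 -> dart_deg G i 1 <= i.-1 * n_deg G i.
  by move=> i4; apply: dart_deg_leaves => //; lia.
move: (row 1%N) (row 2) (row 3) (row 4) (leaves 1%N isT) (leaves 2 isT) (leaves 3 isT).
rewrite !big_ord_recl !big_ord0 /= /bump /= ?addn0 ?add1n in degs card *.
rewrite !dart_deg_eq !dart_deg_neq //.
rewrite !(m_deg_sym _ 2 1) !(m_deg_sym _ 3 1) !(m_deg_sym _ 4 1) (m_deg_sym _ 3 2).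
rewrite (m_deg_sym _ 4 2) (m_deg_sym _ 4 3).
move=> r1 r2 r3 r4 l1 l2 l3.
split; [split; lia| lia| lia| split; try lia].
case/card_gt0P => x; rewrite inE => /eqP dx m23 m24.
have dart0 j (u v : G) : m_deg G 2 j = 0%N -> j != 2 -> adj u v -> deg u = 2 -> deg v != j.
  move=> m0 j2 uv du; apply/eqP => dv.
  suff : 0 < dart_deg G 2 j by rewrite dart_deg_neq 1?eq_sym // m0.
  by apply/card_gt0P; exists (u, v); rewrite inE /= uv du dv !eqxx.
have le2 : forall v : G, deg v <= 2.
  apply: (path_of_deg2 conn dx) => u v uv du.
  have := dart0 _ _ _ m23 isT uv du; have := dart0 _ _ _ m24 isT uv du.
  by have := dk v; lia.
apply/eqP; rewrite addn_eq0 !cards_eq0.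
by apply/andP; split; apply/eqP/setP => v; rewrite !inE; have := le2 v; lia.
Qed.


Local Open Scope ring_scope.

(** * Numerical bounds on edge weights *)

Lemma expR_ge_series (R : realType) (x : R) n : 0 <= x ->
  series (exp_coeff x) n <= expR x.
Proof.
move=> x0; apply: nondecreasing_cvgn_le; last exact: is_cvg_series_exp_coeff.
apply/nondecreasing_seqP => k.
by rewrite seriesSr lerDl exp_coeff_ge0.
Qed.

(** For x in [0, 1] the terms of the exponential series at least halve from
    rank 1 on, so twice the first omitted term bounds the tail.  Equivalently,
    the partial sums corrected by that quantity decrease. *)
Lemma expR_le_series (R : realType) (x : R) n : 0 <= x <= 1 ->
  expR x <= series (exp_coeff x) n.+1 + 2 * exp_coeff x n.+1.
Proof.
move=> /andP[x0 x1].
pose u k := series (exp_coeff x) k.+1 + 2 * exp_coeff x k.+1.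
have uS k : u k.+1 <= u k.
  rewrite /u seriesSr -addrA lerD2l.
  suff : exp_coeff x k.+2 <= exp_coeff x k.+1 / 2 by lra.
  rewrite /exp_coeff /= exprS factS natrM invfM.
  have c0 : 0 <= x ^+ k.+1 / (k.+1)`!%:R by rewrite divr_ge0 ?exprn_ge0.
  have k2 : x / k.+2%:R <= 2^-1.
    rewrite ler_pdivrMr ?ltr0n //.
    have : (2 : R) <= k.+2%:R by rewrite ler_nat.
    by move=> ?; lra.
  have := ler_wpM2r c0 k2.
  by rewrite mulrACA [_ / 2]mulrC.
have ule k : (n <= k)%N -> u k <= u n.
  elim: k => [|k IHk]; first by rewrite leqn0 => /eqP->.
  rewrite leq_eqVlt => /orP[/eqP->//|/IHk]; exact: le_trans.
apply: limr_le; first exact: is_cvg_series_exp_coeff.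
exists n.+1 => // -[//|k] /= nk.
apply: le_trans (ule k nk); rewrite /u lerDl.
by rewrite mulr_ge0 // exp_coeff_ge0.
Qed.

Lemma expR_cubic_bounds (R : realType) (x : R) : 0 <= x <= 1 ->
  1 + x + x ^+ 2 / 2 + x ^+ 3 / 6 <= expR x
  <= 1 + x + x ^+ 2 / 2 + x ^+ 3 / 6 + x ^+ 4 / 12.
Proof.
move=> x01; have := expR_le_series 3 x01.
have /(expR_ge_series 4) : 0 <= x by lra.
rewrite !seriesSr /series /= big_geq // /exp_coeff /= ?factS fact0 /=.
rewrite !natrM => ? ?.
by lra.
Qed.

Lemma sqrt_between (R : realType) (a b y : R) :
  0 <= a -> 0 <= b -> a ^+ 2 <= y <= b ^+ 2 -> a <= Num.sqrt y <= b.
Proof.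
move=> a0 b0 /andP[ay yb].
rewrite -[a]ger0_norm // -[b]ger0_norm // -!sqrtr_sqr.
by rewrite !ler_wsqrtr.
Qed.

(** The cubic bounds are too coarse at 1, but sharp enough at 1/4, and
    e = (exp (1/4))^4. *)
Lemma expR1_between (R : realType) : 271 / 100 <= expR (1 : R) <= 68 / 25.
Proof.
have -> : 1 = 4%:R * 4^-1 :> R by lra.
rewrite expRM_natl.
have /expR_cubic_bounds/andP[lo hi] : 0 <= (4^-1 : R) <= 1 by lra.
apply/andP; split.
  by apply: le_trans (lerXn2r 4 _ _ lo); rewrite ?nnegrE ?expR_ge0; lra.
by apply: le_trans (lerXn2r 4 _ _ hi) _; rewrite ?nnegrE ?expR_ge0; lra.
Qed.

Lemma expR_between (R : realType) k (r s x : R) : 0 <= r <= 1 -> 0 <= s <= 1 ->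
  k%:R + r <= x <= k%:R + s ->
  (271 / 100) ^+ k * (1 + r + r ^+ 2 / 2 + r ^+ 3 / 6) <= expR x
  <= (68 / 25) ^+ k * (1 + s + s ^+ 2 / 2 + s ^+ 3 / 6 + s ^+ 4 / 12).
Proof.
move=> r01 s01 /andP[rx xs].
have /andP[elo ehi] := expR1_between R.
have /andP[rlo _] := expR_cubic_bounds r01.
have /andP[_ shi] := expR_cubic_bounds s01.
have split01 y : expR (k%:R + y) = expR 1 ^+ k * expR y :> R.
  by rewrite expRD -[k%:R]mulr1 expRM_natl.
have r3 : 0 <= 1 + r + r ^+ 2 / 2 + r ^+ 3 / 6.
  have /andP[r0 _] := r01.
  by rewrite !addr_ge0 ?divr_ge0 ?exprn_ge0 //; lra.
apply/andP; split.
  apply: le_trans (_ : expR (k%:R + r) <= _); last by rewrite ler_expR.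
  rewrite split01; apply: ler_pM => //; first by rewrite exprn_ge0 //; lra.
  by rewrite lerXn2r // nnegrE ?expR_ge0 //; lra.
apply: le_trans (_ : expR (k%:R + s) <= _); first by rewrite ler_expR.
rewrite split01; apply: ler_pM => //; rewrite ?exprn_ge0 ?expR_ge0 //.
by rewrite lerXn2r // nnegrE ?expR_ge0 //; lra.
Qed.

Definition edge_weight (R : realType) (i j : nat) : R :=
  expR (Num.sqrt ((i%:R - 1) ^+ 2 + (j%:R - 1) ^+ 2)).

Lemma edge_weight_1 (R : realType) j : edge_weight R 1 j.+1 = expR j%:R.
Proof. by rewrite /edge_weight subrr expr0n add0r -natr1 addrK sqrtr_sqr ger0_norm. Qed.

(** The shifted indices make the number under the square root a natural
    number. *)
Lemma edge_weight_sqrt (R : realType) i j :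
  edge_weight R i.+1 j.+1 = expR (Num.sqrt (i ^ 2 + j ^ 2)%N%:R).
Proof. by rewrite /edge_weight -!natr1 !addrK natrD !natrX. Qed.

Lemma sqrt18 (R : realType) : Num.sqrt 18%:R = 3 * Num.sqrt 2 :> R.
Proof.
have -> : 18%:R = 3 ^+ 2 * 2 :> R by lra.
by rewrite sqrtrM ?exprn_ge0 // sqrtr_sqr ger0_norm.
Qed.

Lemma edge_weight_between (R : realType) i j k m (r s lo hi : R) :
  (i ^ 2 + j ^ 2 = m)%N -> 0 <= r <= 1 -> 0 <= s <= 1 ->
  (k%:R + r) ^+ 2 <= m%:R <= (k%:R + s) ^+ 2 ->
  lo <= (271 / 100) ^+ k * (1 + r + r ^+ 2 / 2 + r ^+ 3 / 6) ->
  (68 / 25) ^+ k * (1 + s + s ^+ 2 / 2 + s ^+ 3 / 6 + s ^+ 4 / 12) <= hi ->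
  lo <= edge_weight R i.+1 j.+1 <= hi.
Proof.
move=> ijm r01 s01 rms lo_le le_hi; rewrite edge_weight_sqrt ijm.
have /(expR_between r01 s01)/andP[lo' hi'] : k%:R + r <= Num.sqrt m%:R <= k%:R + s.
  have k0 : 0 <= k%:R :> R by [].
  by apply: sqrt_between => //; lra.
by rewrite (le_trans lo_le lo') (le_trans hi' le_hi).
Qed.

(** The tightest use of these bounds is the positivity of the deficiency of a
    1-2 edge, 4 w 1 4 > w 4 4 + 3 w 1 2, where 80.3 is compared with 77.7. *)
Lemma edge_weight_numerics (R : realType) : let w := edge_weight R in
  [/\ 27 / 10 <= w 1%N 2%N <= 11 / 4, 73 / 10 <= w 1%N 3%N <= 15 / 2 &
      199 / 10 <= w 1%N 4%N <= 81 / 4] /\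
  [/\ 0 <= w 2%N 2%N <= 21 / 5, 0 <= w 2%N 3%N <= 10, 23 <= w 2%N 4%N <= 24,
      0 <= w 3%N 3%N <= 35 / 2 & 36 <= w 3%N 4%N <= 75 / 2] /\
  68 <= w 4%N 4%N <= 141 / 2.
Proof.
rewrite /=; split; [split|split; [split|]].
- by apply: (edge_weight_between (k := 1) (m := 1) (r := 0) (s := 0)) => //; lra.
- by apply: (edge_weight_between (k := 2) (m := 4) (r := 0) (s := 0)) => //; lra.
- by apply: (edge_weight_between (k := 3) (m := 9) (r := 0) (s := 0)) => //; lra.
- by apply: (edge_weight_between (k := 1) (m := 2) (r := 2 / 5) (s := 5 / 12)) => //; lra.
- by apply: (edge_weight_between (k := 2) (m := 5) (r := 1 / 5) (s := 1 / 4)) => //; lra.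
- by apply: (edge_weight_between (k := 3) (m := 10) (r := 3 / 20) (s := 1 / 6)) => //; lra.
- by apply: (edge_weight_between (k := 2) (m := 8) (r := 4 / 5) (s := 5 / 6)) => //; lra.
- by apply: (edge_weight_between (k := 3) (m := 13) (r := 3 / 5) (s := 11 / 18)) => //; lra.
- by apply: (edge_weight_between (k := 4) (m := 18) (r := 6 / 25) (s := 1 / 4)) => //; lra.
Qed.

(** The factor a is the affine function of 1/i + 1/j that is 1 on edges of type
    1-4 and 0 on edges of type 4-4; hence the deficiency measures how far w i j
    lies below the interpolation of these two weights. *)
Definition deficiency (R : realType) (i j : nat) : R :=
  let a := 4 / 3 * (i%:R^-1 + j%:R^-1 - 2^-1) in
  a * edge_weight R 1 4 + (1 - a) * edge_weight R 4 4 - edge_weight R i j.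

(** B2 and B3 are the total deficiencies of the claimed optima.  As an inner
    edge costs at least 25, two of them exceed both optima. *)
Lemma deficiency_numerics (R : realType) : let d := deficiency R in
  let B2 := 2 * d 1%N 3%N + d 3%N 4%N in let B3 := d 1%N 2%N + d 2%N 4%N in
  [/\ [/\ 0 < d 1%N 2%N, 0 < d 1%N 3%N, B2 < 50 & B3 < 50],
      [/\ 25 <= d 2%N 2%N, 25 <= d 2%N 3%N, 25 <= d 2%N 4%N, 25 <= d 3%N 3%N &
       25 <= d 3%N 4%N],
      B3 < d 3%N 3%N & B2 < d 3%N 3%N + d 1%N 3%N].
Proof.
rewrite /deficiency /=.
have [[]] := edge_weight_numerics R.
move: (edge_weight R 1 2) (edge_weight R 1 3) (edge_weight R 1 4).
move: (edge_weight R 2 2) (edge_weight R 2 3) (edge_weight R 2 4).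
move: (edge_weight R 3 3) (edge_weight R 3 4) (edge_weight R 4 4).
move=> w44 w34 w33 w24 w23 w22 w14 w13 w12.
move=> /andP[? ?] /andP[? ?] /andP[? ?] [[]].
move=> /andP[? ?] /andP[? ?] /andP[? ?] /andP[? ?] /andP[? ?] /andP[? ?].
split; [split|split| |]; lra.
Qed.

(** * The index as a maximum minus a total deficiency *)

Lemma edge_weightC (R : realType) i j : edge_weight R i j = edge_weight R j i.
Proof. by rewrite /edge_weight addrC. Qed.

Lemma eSOred_by_degree (R : realType) n (G : sgraph) : (5 <= n)%N -> CT n G ->
  let w := edge_weight R in let m i j := (m_deg G i j)%:R in
  eSOred R G = m 1%N 2%N * w 1%N 2%N + m 1%N 3%N * w 1%N 3%N + m 1%N 4%N * w 1%N 4%N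
    + m 2%N 2%N * w 2%N 2%N + m 2%N 3%N * w 2%N 3%N + m 2%N 4%N * w 2%N 4%N
    + m 3%N 3%N * w 3%N 3%N + m 3%N 4%N * w 3%N 4%N + m 4%N 4%N * w 4%N 4%N.
Proof.
move=> n5 TG /=.
have n1 : (1 < n)%N by lia.
have dk := CT_deg_bounds n1 TG.
have [_ _ _ [m11 _ _ _]] := chemical_tree_counts n5 TG.
have SO2 : eSOred R G *+ 2 =
    \sum_(p : G * G | adj p.1 p.2) edge_weight R (deg p.1) (deg p.2).
  rewrite /eSOred -(sum_darts_edges (P := fun p : G * G => adj p.1 p.2)) //; last first.
    by move=> u v /=; rewrite adj_sym.
  apply: eq_bigr => -[u v] /= uv.
  rewrite big_setU1 ?big_set1 // inE.
  by apply: contraTneq uv => ->; rewrite adj_irrefl.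
move: SO2; rewrite (sum_darts_by_degree _ dk).
under eq_bigr do under eq_bigr do rewrite -mulr_natl.
rewrite !big_ord_recl !big_ord0 /= /bump /= ?addn0 ?add1n.
rewrite !dart_deg_eq !dart_deg_neq // -!muln2 !natrM m11.
rewrite !(m_deg_sym _ 2 1) !(m_deg_sym _ 3 1) !(m_deg_sym _ 4 1) (m_deg_sym _ 3 2).
rewrite (m_deg_sym _ 4 2) (m_deg_sym _ 4 3).
rewrite !(edge_weightC _ 2 1) !(edge_weightC _ 3 1) !(edge_weightC _ 4 1) (edge_weightC _ 3 2).
rewrite (edge_weightC _ 4 2) (edge_weightC _ 4 3).
move=> SO2. lra.
Qed.

Lemma eSOred_deficiency (R : realType) n (G : sgraph) : (5 <= n)%N -> CT n G ->
  let d := deficiency R in let m i j := (m_deg G i j)%:R in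
  eSOred R G = 2 / 3 * (n%:R + 1) * edge_weight R 1 4
    + 1 / 3 * (n%:R - 5) * edge_weight R 4 4
    - (d 1%N 2%N * m 1%N 2%N + d 1%N 3%N * m 1%N 3%N + d 2%N 2%N * m 2%N 2%N
       + d 2%N 3%N * m 2%N 3%N + d 2%N 4%N * m 2%N 4%N + d 3%N 3%N * m 3%N 3%N
       + d 3%N 4%N * m 3%N 4%N).
Proof.
move=> n5 TG /=.
rewrite (eSOred_by_degree R n5 TG) /deficiency.
have [[r1 r2 r3 r4] rn re _] := chemical_tree_counts n5 TG.
have natE a b : a = b -> a%:R = b%:R :> R by move=> ->.
have nE : n = n.-1.+1 by lia.
have {}rn := natE _ _ rn; have {}re := natE _ _ re; have {}nE := natE _ _ nE.
have {}r1 := natE _ _ r1; have {}r2 := natE _ _ r2.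
have {}r3 := natE _ _ r3; have {}r4 := natE _ _ r4.
rewrite -natr1 in nE; rewrite !(natrD, natrM) in r1 r2 r3 r4 rn re.
(* The equations for n and n - 1 form a linear system in m 1 4 and m 4 4. *)
have e14 : (m_deg G 1 4)%:R = 2 / 3 * (n%:R + 1) - (4 / 3 * (m_deg G 1 2)%:R
    + 10 / 9 * (m_deg G 1 3)%:R + 2 / 3 * (m_deg G 2 2)%:R + 4 / 9 * (m_deg G 2 3)%:R
    + 1 / 3 * (m_deg G 2 4)%:R + 2 / 9 * (m_deg G 3 3)%:R + 1 / 9 * (m_deg G 3 4)%:R)
    :> R by lra.
have e44 : (m_deg G 4 4)%:R = 1 / 3 * (n%:R - 5) - (- 1 / 3 * (m_deg G 1 2)%:R
    - 1 / 9 * (m_deg G 1 3)%:R + 1 / 3 * (m_deg G 2 2)%:R + 5 / 9 * (m_deg G 2 3)%:R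
    + 2 / 3 * (m_deg G 2 4)%:R + 7 / 9 * (m_deg G 3 3)%:R + 8 / 9 * (m_deg G 3 4)%:R)
    :> R by lra.
by rewrite e14 e44; field.
Qed.

(** * Configurations with few inner edges *)

(** With a single inner edge, the vertices of degree 2 or 3 are among its ends,
    and all their other neighbours are leaves.  If the edge has type 2-4 or
    3-4 this gives the two extremal configurations.  A 2-2 edge is impossible:
    the tree would be the path on four vertices.  The remaining types are 2-3
    and 3-3; for the latter, the counts alone also allow the case n3 = 1, which
    the numerical bounds discard later. *)
Lemma one_inner_edge (n n1 n2 n3 n4 m12 m13 m22 m23 m24 m33 m34 : nat) :
  (4 < n -> 2 * n2 = m12 + 2 * m22 + m23 + m24 -> 3 * n3 = m13 + m23 + 2 * m33 + m34 ->
  n1 + n2 + n3 + n4 = n -> n1 + 2 * n2 + 3 * n3 + 4 * n4 = 2 * n.-1 ->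
  m12 <= n2 -> m13 <= 2 * n3 ->
  (0 < n2 -> m23 = 0 -> m24 = 0 -> n3 + n4 = 0) ->
  m22 + m23 + m24 + m33 + m34 = 1 ->
  [\/ [/\ n2 = 1, n3 = 0, m12 = 1 & m24 = 1],
      [/\ n2 = 0, n3 = 1, m13 = 2 & m34 = 1] |
      [\/ n2 = 1 /\ n3 = 1, [/\ n2 = 0, n3 = 1, m33 = 1 & m13 = 1] |
          [/\ n2 = 0, n3 = 2 & m33 = 1]]])%N.
Proof.
move=> n5 r2 r3 rn re l2 l3 pathG q1.
have [m24_0|m24_gt0] := posnP m24; last by apply: Or31; split; lia.
have [m34_0|m34_gt0] := posnP m34; last by apply: Or32; split; lia.
apply: Or33; have m22_0 : m22 = 0%N by have [|n2_gt0] := posnP n2; lia.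
have [m33_0|m33_gt0] := posnP m33; first by apply: Or31; lia.
have [n3_le1|n3_gt1] := leqP n3 1; first by apply: Or32; split; lia.
by apply: Or33; split; lia.
Qed.

(** The residue of n fixes n2 + 2 n3 modulo 3 and thereby selects which of the
    configurations with one inner edge can occur. *)
Lemma inner_edge_cases (n n1 n2 n3 n4 m12 m13 m22 m23 m24 m33 m34 : nat) :
  (4 < n -> 2 * n2 = m12 + 2 * m22 + m23 + m24 -> 3 * n3 = m13 + m23 + 2 * m33 + m34 ->
  n1 + n2 + n3 + n4 = n -> n1 + 2 * n2 + 3 * n3 + 4 * n4 = 2 * n.-1 ->
  m12 <= n2 -> m13 <= 2 * n3 ->
  (0 < n2 -> m23 = 0 -> m24 = 0 -> n3 + n4 = 0) ->
  let q := m22 + m23 + m24 + m33 + m34 in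
  let m := (m12, m13, m22, m23, m24, m33, m34) in
  let E1 := n2 = 0 /\ n3 = 0 in
  let E2 := [/\ n2 = 0, n3 = 1, m13 = 2 & m34 = 1] in
  let E3 := [/\ n2 = 1, n3 = 0, m12 = 1 & m24 = 1] in
  [/\ [/\ E1 -> m = (0, 0, 0, 0, 0, 0, 0), E2 -> m = (0, 2, 0, 0, 0, 0, 1) &
          E3 -> m = (1, 0, 0, 0, 1, 0, 0)],
      E1 \/ 0 < q,
      n = 1 %[mod 3] -> [\/ E2, 1 < q | m = (0, 1, 0, 0, 0, 1, 0)] &
      n = 0 %[mod 3] -> [\/ E3, 1 < q | m = (0, 4, 0, 0, 0, 1, 0)]])%N.
Proof.
move=> n5 r2 r3 rn re l2 l3 pathG q m E1 E2 E3.
have nE : n = (n2 + 2 * n3 + 3 * n4 + 2)%N by lia.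
have one := one_inner_edge n5 r2 r3 rn re l2 l3 pathG.
have mE a b c d e f g : [/\ m12 = a, m13 = b & m22 = c] ->
  [/\ m23 = d, m24 = e, m33 = f & m34 = g] -> m = (a, b, c, d, e, f, g).
  by rewrite /m => -[-> -> ->] [-> -> -> ->].
split.
- split=> [[*]|[*]|[*]]; apply: mE; split; lia.
- by rewrite /E1 /q; have [q0|] := posnP q; [left; rewrite /q in q0; split; lia|right].
- move=> nmod; have [q_le1|] := leqP q 1; last by move=> ?; apply: Or32.
  have [q0|q_gt0] := posnP q; first by rewrite /q in q0; exfalso; lia.
  have q1 : (m22 + m23 + m24 + m33 + m34 = 1)%N by apply/eqP; rewrite eqn_leq q_le1.
  case: (one q1) => [[*]|[*]|[[*]|[*]|[*]]]; try (exfalso; lia).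
    by apply: Or31; split.
  by apply: Or33; apply: mE; split; lia.
- move=> nmod; have [q_le1|] := leqP q 1; last by move=> ?; apply: Or32.
  have [q0|q_gt0] := posnP q; first by rewrite /q in q0; exfalso; lia.
  have q1 : (m22 + m23 + m24 + m33 + m34 = 1)%N by apply/eqP; rewrite eqn_leq q_le1.
  case: (one q1) => [[*]|[*]|[[*]|[*]|[*]]]; try (exfalso; lia).
    by apply: Or31; split.
  by apply: Or33; apply: mE; split; lia.
Qed.

(** * The minimal total deficiency *)

(** If the extremal configuration is not attained, then either there are more
    inner edges than it has, and their number times 25 already exceeds its
    deficiency, or there is a single 3-3 edge.  The strict inequality in each
    second alternative is what makes the equality cases exact. *)
Lemma deficiency_trichotomy (R : realType) n (G : sgraph) : (5 <= n)%N -> CT n G ->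
  let d := deficiency R in let m := m_deg G in
  let D := d 1%N 2%N * (m 1%N 2%N)%:R + d 1%N 3%N * (m 1%N 3%N)%:R
    + d 2%N 2%N * (m 2%N 2%N)%:R + d 2%N 3%N * (m 2%N 3%N)%:R
    + d 2%N 4%N * (m 2%N 4%N)%:R + d 3%N 3%N * (m 3%N 3%N)%:R
    + d 3%N 4%N * (m 3%N 4%N)%:R in
  let B2 := 2 * d 1%N 3%N + d 3%N 4%N in
  let B3 := d 1%N 2%N + d 2%N 4%N in
  let E1 := n_deg G 2 = 0%N /\ n_deg G 3 = 0%N in
  let E2 := [/\ n_deg G 2 = 0%N, n_deg G 3 = 1%N, m 1%N 3%N = 2%N & m 3%N 4%N = 1%N] in
  let E3 := [/\ n_deg G 2 = 1%N, n_deg G 3 = 0%N, m 1%N 2%N = 1%N & m 2%N 4%N = 1%N] in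
  [/\ n = 2 %[mod 3] -> (E1 /\ D = 0) \/ (~ E1 /\ 0 < D),
      n = 1 %[mod 3] -> (E2 /\ D = B2) \/ (~ E2 /\ B2 < D) &
      n = 0 %[mod 3] -> (E3 /\ D = B3) \/ (~ E3 /\ B3 < D)].
Proof.
move=> n5 TG /=.
have [[_ r2 r3 _] rn re [_ l2 l3 pathG]] := chemical_tree_counts n5 TG.
have := inner_edge_cases n5 r2 r3 rn re l2 l3 pathG; rewrite /=.
have [] := deficiency_numerics R; clear r2 r3 rn re l2 l3 pathG.
move: (m_deg G 1 2) (m_deg G 1 3) (m_deg G 2 2) (m_deg G 2 3) => m12 m13 m22 m23.
move: (m_deg G 2 4) (m_deg G 3 3) (m_deg G 3 4) => m24 m33 m34.
move: (deficiency R 1 2) (deficiency R 1 3) (deficiency R 2 2) => d12 d13 d22.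
move: (deficiency R 2 3) (deficiency R 2 4) (deficiency R 3 3) => d23 d24 d33.
move: (deficiency R 3 4) => d34.
move=> [d12_gt0 d13_gt0 B2lt B3lt] [d22_ge d23_ge d24_ge d33_ge d34_ge].
move=> B3d33 B2d33 [[E1m E2m E3m] alt1 alt2 alt3].
set D := _ + d34 * m34%:R.
have p12 : 0 <= d12 * m12%:R by rewrite mulr_ge0 ?ler0n // ltW.
have p13 : 0 <= d13 * m13%:R by rewrite mulr_ge0 ?ler0n // ltW.
(* Each inner edge contributes at least 25, the other edges nonnegatively. *)
have D_ge : 25 * (m22 + m23 + m24 + m33 + m34)%N%:R <= D.
  have mono x k : 25 <= x -> 25 * k%:R <= x * k%:R :> R.
    by move=> ?; rewrite ler_wpM2r.
  rewrite !natrD /D.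
  have := mono _ m22 d22_ge; have := mono _ m23 d23_ge; have := mono _ m24 d24_ge.
  by have := mono _ m33 d33_ge; have := mono _ m34 d34_ge; lra.
have Bmax x : x < 50 -> (1 < m22 + m23 + m24 + m33 + m34)%N -> x < D.
  by move=> x50; rewrite -(ler_nat R) => ?; lra.
have DE a b c e f g h : (m12, m13, m22, m23, m24, m33, m34) = (a, b, c, e, f, g, h) ->
    D = d12 * a%:R + d13 * b%:R + d22 * c%:R + d23 * e%:R + d24 * f%:R
        + d33 * g%:R + d34 * h%:R.
  by rewrite /D => -[-> -> -> -> -> -> ->].
have {}E1m := fun e => DE _ _ _ _ _ _ _ (E1m e).
have {}E2m := fun e => DE _ _ _ _ _ _ _ (E2m e).
have {}E3m := fun e => DE _ _ _ _ _ _ _ (E3m e).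
have strict (E : Prop) B : (E -> D = B) -> B < D -> (E /\ D = B) \/ (~ E /\ B < D).
  by move=> EB BD; right; split=> // /EB DB; rewrite DB ltxx in BD.
split=> nmod.
- have {}E1m : n_deg G 2 = 0%N /\ n_deg G 3 = 0%N -> D = 0 by move=> /E1m; lra.
  case: alt1 => [E|q_gt0]; [by left; split => //; apply: E1m|apply: strict => //].
  by apply: lt_le_trans D_ge; rewrite mulr_gt0 // ltr0n.
- have {}E2m : [/\ n_deg G 2 = 0%N, n_deg G 3 = 1%N, m13 = 2%N & m34 = 1%N] ->
      D = 2 * d13 + d34 by move=> /E2m; lra.
  case: (alt2 nmod) => [E|q_gt1|/DE DEq]; first by left; split => //; apply: E2m.
    by apply: strict => //; apply: Bmax.
  by apply: strict => //; lra.
- have {}E3m : [/\ n_deg G 2 = 1%N, n_deg G 3 = 0%N, m12 = 1%N & m24 = 1%N] ->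
      D = d12 + d24 by move=> /E3m; lra.
  case: (alt3 nmod) => [E|q_gt1|/DE DEq]; first by left; split => //; apply: E3m.
    by apply: strict => //; apply: Bmax.
  by apply: strict => //; lra.
Qed.

Lemma le_and_eq_iff (R : realType) (E : Prop) (x B D b : R) :
  (E /\ D = b) \/ (~ E /\ b < D) -> x + D = B + b -> x <= B /\ (x = B <-> E).
Proof.
by case=> -[HE Db] xB; split; [lra|split=> // _; lra|lra|split=> // ?; exfalso; lra].
Qed.

Theorem theorem3p2 (R : realType) (n : nat) (T : sgraph)
    (hn : (5 <= n)%N) (hT : CT n T) :
  (n = 2 %[mod 3] ->
     let B : R := 2 / 3 * (n%:R + 1) * expR 3
                  + 1 / 3 * (n%:R - 5) * expR (3 * Num.sqrt 2) in
     eSOred R T <= B /\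
     (eSOred R T = B <-> n_deg T 2 = 0%N /\ n_deg T 3 = 0%N)) /\
  (n = 1 %[mod 3] ->
     let B : R := 2 * expR 2 + expR (Num.sqrt 13)
                  + 1 / 3 * (2 * n%:R - 5) * expR 3
                  + 1 / 3 * (n%:R - 7) * expR (3 * Num.sqrt 2) in
     eSOred R T <= B /\
     (eSOred R T = B <->
        [/\ n_deg T 2 = 0%N, n_deg T 3 = 1%N, m_deg T 1 3 = 2%N
          & m_deg T 3 4 = 1%N])) /\
  (n = 0 %[mod 3] ->
     let B : R := expR 1 + expR (Num.sqrt 10)
                  + 1 / 3 * (2 * n%:R - 3) * expR 3
                  + 1 / 3 * (n%:R - 6) * expR (3 * Num.sqrt 2) in
     eSOred R T <= B /\
     (eSOred R T = B <->
        [/\ n_deg T 2 = 1%N, n_deg T 3 = 0%N, m_deg T 1 2 = 1%N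
          & m_deg T 2 4 = 1%N])).
Proof.
have /= SO := eSOred_deficiency R hn hT.
have /= [C1 C2 C3] := deficiency_trichotomy R hn hT.
move: SO C1 C2 C3; set D := _ + deficiency R 3 4 * _ => SO C1 C2 C3.
have w12 : edge_weight R 1 2 = expR 1 by rewrite edge_weight_1.
have w13 : edge_weight R 1 3 = expR 2 by rewrite edge_weight_1.
have w14 : edge_weight R 1 4 = expR 3 by rewrite edge_weight_1.
have w24 : edge_weight R 2 4 = expR (Num.sqrt 10) by rewrite edge_weight_sqrt.
have w34 : edge_weight R 3 4 = expR (Num.sqrt 13) by rewrite edge_weight_sqrt.
have w44 : edge_weight R 4 4 = expR (3 * Num.sqrt 2).
  by rewrite edge_weight_sqrt sqrt18.
split; [|split] => nmod; apply: le_and_eq_iff.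
- exact: C1 nmod.
- by rewrite SO w14 w44; lra.
- exact: C2 nmod.
- by rewrite SO /deficiency w13 w14 w34 w44; lra.
- exact: C3 nmod.
- by rewrite SO /deficiency w12 w14 w24 w44; lra.
Qed.
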